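(* Let $Q_1=(X_1,*_1)$ and $Q_2=(X_2,*_2)$ be two quandles, with biquandle structures $\{\beta^1_y\mid y\in X_1\}$ on $Q_1$ and $\{\beta^2_y\mid y\in X_2\}$ on $Q_2$. Then the biquandle defined by $\{\beta^1_y\mid y\in X_1\}$ on $Q_1$ is isomorphic to the biquandle defined by $\{\beta^2_y\mid y\in X_2\}$ on $Q_2$ if and only if there is a quandle isomorphism $F\colon Q_1\to Q_2$ such that $F\beta^1_y=\beta^2_{F(y)}F$ for every $y\in X_1$.
   Context: A quandle is a set $Q$ with a binary operation $*$ such that (1) $x*x=x$ for all $x$; (2) for every $y$ the map $S_y(x)=x*y$ is a bijection of $Q$; (3) $(x*y)*z=(x*z)*(y*z)$ for all $x,y,z$. A quandle isomorphism is a bijective map preserving $*$; $Aut(Q)$ is the group of quandle isomorphisms $Q\to Q$. A biquandle is a set $B$ with two binary operations $\underline{\ast},\overline{\ast}$ such that (1) $x\,\underline{\ast}\,x=x\,\overline{\ast}\,x$ for all $x$; (2) the maps $x\mapsto x\,\underline{\ast}\,y$ and $x\mapsto x\,\overline{\ast}\,y$ (for every $y\in B$) are bijections of $B$, and the map $(x,y)\mapsto(y\,\overline{\ast}\,x,\;x\,\underline{\ast}\,y)$ is a bijection of $B\times B$; (3) for all $x,y,z\in B$: $(x\,\underline{\ast}\,y)\,\underline{\ast}\,(z\,\underline{\ast}\,y)=(x\,\underline{\ast}\,z)\,\underline{\ast}\,(y\,\overline{\ast}\,z)$, $(x\,\underline{\ast}\,y)\,\overline{\ast}\,(z\,\underline{\ast}\,y)=(x\,\overline{\ast}\,z)\,\underline{\ast}\,(y\,\overline{\ast}\,z)$,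 and $(x\,\overline{\ast}\,y)\,\overline{\ast}\,(z\,\overline{\ast}\,y)=(x\,\overline{\ast}\,z)\,\overline{\ast}\,(y\,\underline{\ast}\,z)$. A biquandle isomorphism is a bijection preserving both operations. A biquandle structure on a quandle $Q=(X,* )$ is a family of automorphisms $\{\beta_y\mid y\in X\}\subset Aut(Q)$ such that (1) $\beta_{\beta_y(x*y)}\beta_y=\beta_{\beta_x(y)}\beta_x$ for every $x,y\in X$; (2) the map $y\mapsto\beta_y(y)$ is a bijection of $X$. The biquandle defined by this biquandle structure is $(X,\underline{\ast},\overline{\ast})$ with $x\,\underline{\ast}\,y=\beta_y(x*y)$ and $x\,\overline{\ast}\,y=\beta_y(x)$. *)

(* Defs.v *)
From Stdlib Require Import ClassicalEpsilon.
From mathcomp Require Import all_boot.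

Set Implicit Arguments.
Unset Strict Implicit.
Unset Printing Implicit Defensive.

(* [bijective] provides an inverse function: building one from an injective
   and surjective map needs choice. *)
Lemma inj_surj_bij (A B : Type) (f : A -> B) :
  injective f -> (forall y, exists x, f x = y) -> bijective f.
Proof.
move=> f_inj f_surj.
pose g y := proj1_sig (constructive_indefinite_description _ (f_surj y)).
have gK : cancel g f.
  by move=> y; rewrite /g; case: constructive_indefinite_description.
by exists g => // x; apply: f_inj; rewrite gK.
Qed.

Record quandle := Quandle {
  qsort :> Type;
  qop : qsort -> qsort -> qsort;
  qopxx : forall x, qop x x = x;
  qop_bij : forall y, bijective (fun x => qop x y);
  qopD : forall x y z, qop (qop x y) z = qop (qop x z) (qop y z)
}.

Definition quandle_iso (Q1 Q2 : quandle) (F : Q1 -> Q2) : Prop :=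
  bijective F /\ {morph F : x y / qop x y >-> qop x y}.

(* [bund x y] and [bover x y] are the underlined and the overlined product. *)
Record biquandle := Biquandle {
  bsort :> Type;
  bund : bsort -> bsort -> bsort;
  bover : bsort -> bsort -> bsort;
  bundxx : forall x, bund x x = bover x x;
  bund_bij : forall y, bijective (fun x => bund x y);
  bover_bij : forall y, bijective (fun x => bover x y);
  bswitch_bij :
    bijective (fun p : bsort * bsort => (bover p.2 p.1, bund p.1 p.2));
  bund_und : forall x y z,
    bund (bund x y) (bund z y) = bund (bund x z) (bover y z);
  bund_over : forall x y z,
    bover (bund x y) (bund z y) = bund (bover x z) (bover y z);
  bover_over : forall x y z,
    bover (bover x y) (bover z y) = bover (bover x z) (bund y z)
}.

Definition biquandle_iso (B1 B2 : biquandle) (F : B1 -> B2) : Prop :=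
  [/\ bijective F,
      {morph F : x y / bund x y >-> bund x y} &
      {morph F : x y / bover x y >-> bover x y}].

Definition biquandle_isomorphic (B1 B2 : biquandle) : Prop :=
  exists F : B1 -> B2, biquandle_iso F.

Record biquandle_structure (Q : quandle) := BiquandleStructure {
  beta :> Q -> Q -> Q;
  beta_aut : forall y, quandle_iso (beta y);
  beta_comm : forall x y,
    beta (beta y (qop x y)) \o beta y =1 beta (beta x y) \o beta x;
  beta_diag : bijective (fun y => beta y y)
}.

Section BiquandleOf.

Variables (Q : quandle) (b : biquandle_structure Q).

Definition und (x y : Q) : Q := b y (qop x y).
Definition over (x y : Q) : Q := b y x.

Lemma betaM y : {morph b y : u v / qop u v}.
Proof. by case: (beta_aut b y). Qed.

Lemma undxx x : und x x = over x x.
Proof. by rewrite /und qopxx. Qed.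

Lemma und_bij y : bijective (und^~ y).
Proof. by case: (beta_aut b y) => bij_b _; apply: bij_comp bij_b (qop_bij y). Qed.

Lemma over_bij y : bijective (over^~ y).
Proof. by case: (beta_aut b y). Qed.

Lemma switch_bij : bijective (fun p : Q * Q => (over p.2 p.1, und p.1 p.2)).
Proof.
have [d dK Kd] := beta_diag b.
have diagE x y : b (und x y) (b y y) = b (over y x) (over y x).
  exact: (beta_comm b x y y).
apply: inj_surj_bij => [[x y] [x' y'] /= [eq_o eq_u] | [u v]].
  have eq_y : y = y'.
    apply: (can_inj dK); apply: (bij_inj (over_bij (und x y))).
    by rewrite /over diagE eq_u diagE eq_o.
  by move: eq_u; rewrite eq_y => /(bij_inj (und_bij y')) ->.
have [bv' _ bvK] := over_bij v.
pose y := d (bv' (b u u)).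
have [uy' _ uyK] := und_bij y.
exists (uy' v, y) => /=; have := uyK v; set x := uy' v => eq_v.
congr (_, _) => //; apply: (can_inj dK).
rewrite -[LHS]diagE eq_v /y Kd; exact: bvK.
Qed.

Lemma und_und x y z : und (und x y) (und z y) = und (und x z) (over y z).
Proof. by rewrite /und /over -!betaM -!qopD; apply: beta_comm. Qed.

Lemma und_over x y z : over (und x y) (und z y) = und (over x z) (over y z).
Proof. by rewrite /und /over -!betaM; apply: beta_comm. Qed.

Lemma over_over x y z : over (over x y) (over z y) = over (over x z) (und y z).
Proof. by symmetry; apply: beta_comm. Qed.

Definition biquandle_of : biquandle :=
  Biquandle undxx und_bij over_bij switch_bij und_und und_over over_over.

End BiquandleOf.

(* Main.v *)
Require Import Defs.
From mathcomp Require Import all_boot.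

(** The same map [F] serves in both directions. Since [over x y] is [b y x], preserving the
    overlined product is exactly the intertwining condition. Given it, preserving
    [und x y = b y (qop x y)] amounts to preserving [qop], because each [b2 (F y)] is injective. *)

Theorem proposition2p7 (Q1 Q2 : quandle)
    (b1 : biquandle_structure Q1) (b2 : biquandle_structure Q2) :
  biquandle_isomorphic (biquandle_of b1) (biquandle_of b2) <->
  exists F : Q1 -> Q2,
    quandle_iso F /\ forall y : Q1, F \o b1 y =1 b2 (F y) \o F.
Proof.
split=> [[F [F_bij Fund Fover]] | [F [[F_bij FM] Fb]]].
- exists F; split=> [|y x]; last exact: (Fover x y).
  split=> // x y; have [b_bij _] := beta_aut b2 (F y).
  (* Both sides have the image [F (bund x y)] under [b2 (F y)]. *)
  by apply: (bij_inj b_bij); rewrite -[LHS](Fover (qop x y) y); apply: (Fund x y).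
- exists F; split=> // x y; last exact: (Fb y x).
  (* Once [F] is pulled out of the quandle product, this is the intertwining relation at the point
     [qop x y]. *)
  by rewrite /= /und -FM; apply: (Fb y (qop x y)).
Qed.
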